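(* Let $S \subseteq \mathbb{R}^d$ be nonempty, compact and convex, let $\mathcal{X} \subseteq \mathbb{R}^p$, and let $(x,c) \sim \mathcal{D}$ be a random pair with $x \in \mathcal{X}$, $c \in \mathbb{R}^d$ and $\mathbb{E}\|c\| < \infty$. Suppose that: 1. $\mathbb{P}_x\left(|W^*(\mathbb{E}[c|x])| = 1\right) = 1$, i.e., almost surely $W^*(\mathbb{E}[c|x])$ is a singleton; 2. for all $x \in \mathcal{X}$, the conditional distribution of $c$ given $x$ is centrally symmetric about its mean $\mathbb{E}[c|x]$; 3. for all $x \in \mathcal{X}$, the conditional distribution of $c$ given $x$ is continuous on all of $\mathbb{R}^d$; 4. the interior of $S$ is nonempty. Then any minimizer $f$ of the SPO+ risk $\min_f \mathbb{E}_{(x,c)\sim\mathcal{D}}[\ell_{\mathrm{SPO+}}(f(x),c)]$ (over all measurable $f : \mathcal{X} \to \mathbb{R}^d$) satisfies $f(x) = \mathbb{E}[c|x]$ almost surely with respect to the distribution of $x$, and is also a minimizer of the SPO risk $\min_f \mathbb{E}_{(x,c)\sim\mathcal{D}}[\ell_{\mathrm{SPO}}(f(x),c)]$ (over all measurable $f : \mathcal{X} \to \mathbb{R}^d$). Thus the SPO+ loss function is Fisher consistent with respect to the SPO loss.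
   Context: For $c \in \mathbb{R}^d$: $z^*(c) := \min_{w\in S} c^Tw$, $W^*(c) := \arg\min_{w\in S} c^Tw$, and $w^*(\cdot):\mathbb{R}^d \to S$ is a fixed deterministic oracle, i.e., an arbitrary fixed mapping with $w^*(c)\in W^*(c)$ for all $c$. The (unambiguous) SPO loss is $\ell_{\mathrm{SPO}}(\hat c,c) := \max_{w\in W^*(\hat c)} c^Tw - z^*(c)$. The SPO+ loss is $\ell_{\mathrm{SPO+}}(\hat c,c) := \max_{w\in S}\{c^Tw - 2\hat c^Tw\} + 2\hat c^Tw^*(c) - z^*(c)$. A random vector $v$ is centrally symmetric about its mean if $v$ is equal in distribution to $2\mathbb{E}[v]-v$. ''Continuous on all of $\mathbb{R}^d$'' means absolutely continuous with respect to Lebesgue measure, with support equal to all of $\mathbb{R}^d$. A loss $\ell(\cdot,\cdot)$ is Fisher consistent with respect to the SPO loss if every minimizer of $\mathbb{E}_{(x,c)\sim\mathcal{D}}[\ell(f(x),c)]$ over all measurable $f:\mathcal{X}\to\mathbb{R}^d$ also minimizes $\mathbb{E}_{(x,c)\sim\mathcal{D}}[\ell_{\mathrm{SPO}}(f(x),c)]$ over all measurable $f$. Conditional distributions of $c$ given $x$ are taken as a fixed regular conditional distribution. *)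

(* Defs.v *)
From HB Require Import structures.
From mathcomp Require Export all_boot all_order all_algebra.
From mathcomp Require Export all_classical all_reals all_analysis.

Set Implicit Arguments.
Unset Strict Implicit.
Unset Printing Implicit Defensive.

Import Order.TTheory GRing.Theory Num.Theory.
Import numFieldNormedType.Exports.

Local Open Scope classical_set_scope.
Local Open Scope ring_scope.

HB.instance Definition _ (R : realType) (m n : nat) :=
  Measurable.copy 'M[R]_(m, n) (g_sigma_algebraType (@open 'M[R]_(m, n))).

(** A nonempty subset [X] of [R^p] as a measurable space, with the trace of the
    Borel sigma-algebra.  Nonemptiness is there because [measurableType]s are
    pointed; a set carrying a probability measure is nonempty anyway. *)
Section feature_space.
Context (R : realType) (p : nat) (X : set 'rV[R]_p) (X0 : X !=set0).

Definition feature_space (_ : X !=set0) : Type := X.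

HB.instance Definition _ := Choice.on (feature_space X0).
HB.instance Definition _ := isPointed.Build (feature_space X0)
  (SigSub (mem_set (svalP (cid X0)))).
HB.instance Definition _ := Measurable.copy (feature_space X0)
  (g_sigma_algebra_preimageType (set_val : feature_space X0 -> 'rV[R]_p)).

End feature_space.

Section linear_optimization.
Context (R : realType) (d : nat).
Implicit Types (S : set 'rV[R]_d) (c w : 'rV[R]_d).

Definition dot (u v : 'rV[R]_d) : R := \sum_i u 0 i * v 0 i.

(** In this section [inf] and [sup] range over images of nonempty compact sets
    under continuous maps when [S] is nonempty and compact: they are then a
    minimum and maxima. *)
Definition zstar S c : R := inf [set dot c w | w in S].

Definition Wstar S c : set 'rV[R]_d :=
  [set w | S w /\ forall v, S v -> dot c w <= dot c v].

(** No measurability is asked of [wstar].  Up to a Lebesgue-null set of costs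
    [Wstar S c] is a singleton, so [wstar] is almost everywhere equal to a Borel
    map, and the integral of the nonnegative [spo_plus_loss] (a supremum over
    simple functions below it) ignores null sets. *)
Definition optimization_oracle S (wstar : 'rV[R]_d -> 'rV[R]_d) : Prop :=
  forall c, Wstar S c (wstar c).

Definition spo_loss S (chat c : 'rV[R]_d) : R :=
  sup [set dot c w | w in Wstar S chat] - zstar S c.

Definition spo_plus_loss S (wstar : 'rV[R]_d -> 'rV[R]_d)
    (chat c : 'rV[R]_d) : R :=
  sup [set dot c w - 2 * dot chat w | w in S]
  + 2 * dot chat (wstar c) - zstar S c.

End linear_optimization.

Section measures_on_Rd.
Context (R : realType).

(** Lebesgue measure on [R^d] as the [d]-fold product of Lebesgue measure on
    [R]; it is the unit mass on the one-point space [R^0]. *)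
Fixpoint lebesgue_rV (d : nat) : set 'rV[R]_d -> \bar R :=
  match d with
  | 0 => \d_(0 : 'rV[R]_0)
  | n.+1 => pushforward (lebesgue_measure \x @lebesgue_rV n)%E
      (fun q : R * 'rV[R]_n => row_mx (q.1%:M : 'M[R]_1) q.2 : 'rV[R]_n.+1)
  end.

Definition support_of d (mu : set 'rV[R]_d -> \bar R) : set 'rV[R]_d :=
  [set v | forall U, open U -> U v -> (0 < mu U)%E].

(** A coordinate whose integral is not finite is given mean [0]; for the
    conditional laws of an integrable random vector this concerns only a null
    set of features. *)
Definition mean_of d (mu : {measure set 'rV[R]_d -> \bar R}) : 'rV[R]_d :=
  \row_i (\int[mu]_v v 0 i).

Definition centrally_symmetric d (mu : {measure set 'rV[R]_d -> \bar R}) : Prop :=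
  forall A, measurable A ->
    pushforward mu (fun v => 2 *: mean_of mu - v) A = mu A.

Definition continuous_on_all_of_Rd d (mu : set 'rV[R]_d -> \bar R) : Prop :=
  mu `<< @lebesgue_rV d /\ support_of mu = setT.

End measures_on_Rd.

Section prediction.
Context {dT : measure_display} {T : measurableType dT} {R : realType} {d : nat}.
Implicit Types (D : probability (T * 'rV[R]_d)%type R).
Implicit Types (l : 'rV[R]_d -> 'rV[R]_d -> R) (f : T -> 'rV[R]_d).

Definition feature_law D : set T -> \bar R := pushforward D fst.

Definition regular_conditional_law D (k : R.-pker T ~> 'rV[R]_d) : Prop :=
  forall A B, measurable A -> measurable B ->
    D (A `*` B) = (\int[feature_law D]_(x in A) k x B)%E.

Definition risk D l f : \bar R := (\int[D]_q (l (f q.1) q.2)%:E)%E.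

Definition risk_minimizer D l f : Prop :=
  measurable_fun setT f /\
  forall g, measurable_fun setT g -> (risk D l f <= risk D l g)%E.

Definition fisher_consistent D l lref : Prop :=
  forall f, risk_minimizer D l f -> risk_minimizer D lref f.

End prediction.

(* Main.v *)
(** Write [z] for [zstar S] and [m x] for the conditional mean.  Since
    [spo_plus_loss S wstar a c = - z (2 a - c) + 2 a . wstar c - z c], the SPO+
    losses of [m x] and of [f x] at [c] differ by a function that is odd under
    the reflection [c |-> 2 m x - c], up to a defect bounded below by a continuous
    [spo_plus_gap] whose value at [c = m x - f x] is at least the width of [S] in
    the direction [m x - f x].  The reflection preserves the joint law, so
    replacing a minimizer [f] by [m] where [m - f] is bounded shows that the gap
    vanishes almost surely; as the conditional laws have full support and [S] has
    nonempty interior, [f = m].  For the SPO loss, averaging over the reflection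
    replaces the random cost by its mean, where [m x] selects an optimal
    decision.

    The oracle need not be measurable, so the SPO+ risk is a lower integral: it is
    additive when one of the two summands is measurable. *)

From HB Require Import structures.
Require Import Defs.
From mathcomp Require Import lra measurable_realfun.

Set Implicit Arguments.
Unset Strict Implicit.
Unset Printing Implicit Defensive.

Import Order.TTheory GRing.Theory Num.Theory.
Import numFieldNormedType.Exports.

Local Open Scope classical_set_scope.
Local Open Scope ring_scope.

(** * Bilinearity, bounds and continuity of the dot product *)

Section dot_product.
Context (R : realType) (d : nat).
Implicit Types u v w : 'rV[R]_d.

Lemma dotC u v : dot u v = dot v u.
Proof. by apply: eq_bigr => i _; rewrite mulrC. Qed.

Lemma dotDl u v w : dot (u + v) w = dot u w + dot v w.
Proof. by rewrite -big_split; apply: eq_bigr => i _; rewrite mxE mulrDl. Qed.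

Lemma dotZl (a : R) u w : dot (a *: u) w = a * dot u w.
Proof. by rewrite mulr_sumr; apply: eq_bigr => i _; rewrite mxE mulrA. Qed.

Lemma dotNl u w : dot (- u) w = - dot u w.
Proof. by rewrite -scaleN1r dotZl mulN1r. Qed.

Lemma dotBl u v w : dot (u - v) w = dot u w - dot v w.
Proof. by rewrite dotDl dotNl. Qed.

Lemma dotDr u v w : dot w (u + v) = dot w u + dot w v.
Proof. by rewrite dotC dotDl !(dotC w). Qed.

Lemma dotZr (a : R) u w : dot w (a *: u) = a * dot w u.
Proof. by rewrite dotC dotZl (dotC w). Qed.

Lemma dot_gt0 u : u != 0 -> 0 < dot u u.
Proof.
move=> u0; rewrite lt_neqAle eq_sym sumr_ge0 ?andbT; last first.
  by move=> i _; rewrite -expr2 sqr_ge0.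
apply: contra u0; rewrite psumr_eq0; last by move=> i _; rewrite -expr2 sqr_ge0.
move=> /allP h; apply/eqP/rowP => i; rewrite mxE.
by have := h i (mem_index_enum i); rewrite -expr2 sqrf_eq0 => /eqP.
Qed.

Lemma coord_le_norm u i : `|u 0 i| <= `|u|.
Proof.
rewrite [leRHS]/Num.norm /= mx_normrE.
exact: (le_bigmax _ (fun ij => `|u ij.1 ij.2|) (ord0, i)).
Qed.

(** The norm on row vectors is the sup norm, hence the factor [d]. *)
Lemma norm_dot_le u w : `|dot u w| <= d%:R * `|w| * `|u|.
Proof.
apply: le_trans (ler_norm_sum _ _ _) _.
have -> : d%:R * `|w| * `|u| = \sum_(i < d) `|u| * `|w|.
  by rewrite sumr_const card_ord -mulrA mulr_natl (mulrC `|w|).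
by apply: ler_sum => i _; rewrite normrM ler_pM// coord_le_norm.
Qed.

Lemma continuous_dotr u : continuous (dot u).
Proof.
move=> w; rewrite /dot; apply: (@cvg_big _ _ +%R 0 predT _ _ (nbhs w)) => [|i _].
  exact: add_continuous.
by apply: (@cvgMr _ _ (nbhs w)); exact: coord_continuous.
Qed.

End dot_product.

(** * The optimal value function, and pointwise inequalities for both losses *)

Section support_function.
Context (R : realType) (d : nat) (S : set 'rV[R]_d).
Hypotheses (S0 : S !=set0) (Sc : compact S).
Implicit Types (a c w : 'rV[R]_d).

Let z := zstar S.

Lemma Wstar_nonempty c : Wstar S c !=set0.
Proof.
have [w Sw wm] := compact_EVT_min S0 Sc
  (continuous_subspaceT (@continuous_dotr _ _ c)).
by exists w; split; [exact: set_mem|move=> v Sv; apply: wm; exact: mem_set].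
Qed.

Lemma zstar_Wstar c w : Wstar S c w -> z c = dot c w.
Proof.
move=> [Sw wm]; apply/eqP; rewrite eq_le; apply/andP; split.
  by apply: ge_inf; [exists (dot c w) => _ [v Sv <-]; exact: wm|exists w].
by apply: lb_le_inf; [exists (dot c w), w|move=> _ [v Sv <-]; exact: wm].
Qed.

Lemma zstar_le c w : S w -> z c <= dot c w.
Proof.
by move=> Sw; have [v vW] := Wstar_nonempty c; rewrite (zstar_Wstar vW); exact: vW.2.
Qed.

Lemma Wstar_zstar c w : S w -> z c = dot c w -> Wstar S c w.
Proof. by move=> Sw e; split=> // v Sv; rewrite -e; exact: zstar_le. Qed.

Lemma dot_bounded : exists2 M : R, 0 <= M &
  forall u w, S w -> `|dot u w| <= M * `|u|.
Proof.
have [M [_ SM]] := compact_bounded Sc.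
exists (d%:R * (`|M| + 1)); first by rewrite mulr_ge0// addr_ge0.
move=> u w Sw; apply: le_trans (norm_dot_le _ _) _.
rewrite ler_wpM2r// ler_wpM2l//; apply: SM => //.
by rewrite (le_lt_trans (ler_norm M))// ltrDl.
Qed.

Lemma zstar_lipschitz M : (forall u w, S w -> `|dot u w| <= M * `|u|) ->
  forall a c, `|z a - z c| <= M * `|a - c|.
Proof.
move=> dotM.
suff h a c : z a - z c <= M * `|a - c|.
  by move=> a c; rewrite ler_norml h lerNl opprB distrC h.
have [w wW] := Wstar_nonempty c.
rewrite (zstar_Wstar wW) (le_trans (lerB (zstar_le a wW.1) (lexx _)))//.
by rewrite -dotBl (le_trans (ler_norm _))// dotM//; exact: wW.1.
Qed.

Lemma zstar_norm_le M : (forall u w, S w -> `|dot u w| <= M * `|u|) ->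
  forall c, `|z c| <= M * `|c|.
Proof.
move=> dotM c; have [w wW] := Wstar_nonempty c.
by rewrite (zstar_Wstar wW) dotM//; exact: wW.1.
Qed.

Lemma zstar_continuous : continuous z.
Proof.
have [M M0 dotM] := dot_bounded.
move=> a; apply/(@cvgrPdist_lt _ _ _ (nbhs a)) => e e0.
near=> c.
apply: le_lt_trans (zstar_lipschitz dotM a c) _.
(* Dividing by [M + 1] also covers [M = 0]. *)
have : `|a - c| < e / (M + 1).
  near: c; apply/nbhs_ballP; exists (e / (M + 1)) => /=.
    by rewrite divr_gt0// ltr_wpDl.
  by move=> c; rewrite -ball_normE.
rewrite ltr_pdivlMr ?ltr_wpDl// mulrDr mulr1 mulrC.
by apply: le_lt_trans; rewrite lerDl.
Unshelve. all: by end_near. Qed.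

Lemma spo_plus_lossE wstar a c : spo_plus_loss S wstar a c =
  - z (2 *: a - c) + 2 * dot a (wstar c) - z c.
Proof.
rewrite /spo_plus_loss; congr (_ + _ - _).
rewrite /z /zstar /inf opprK; congr sup.
apply/seteqP; split=> [_ [w Sw <-]|_ [_ [w Sw <-] <-]].
  by exists (dot (2 *: a - c) w); [exists w|rewrite dotBl dotZl opprB].
by exists w => //; rewrite dotBl dotZl opprB.
Qed.

Definition spo_support a c := sup [set dot c w | w in Wstar S a].

Lemma has_sup_Wstar a c : has_sup [set dot c w | w in Wstar S a].
Proof.
have [M _ dotM] := dot_bounded.
have [w wW] := Wstar_nonempty a.
split; first by exists (dot c w), w.
exists (M * `|c|) => _ [v vW <-].
by rewrite (le_trans (ler_norm _))// dotM//; exact: vW.1.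
Qed.

Lemma spo_support_ge a c w : Wstar S a w -> dot c w <= spo_support a c.
Proof.
by move=> wW; apply: (ub_le_sup (has_sup_Wstar a c).2); exists w.
Qed.

Lemma spo_support_le a c r :
  (forall w, Wstar S a w -> dot c w <= r) -> spo_support a c <= r.
Proof.
move=> h; apply: ge_sup; first exact: (has_sup_Wstar a c).1.
by move=> _ [w wW <-]; exact: h.
Qed.

Lemma zstar_le_spo_support a c : z c <= spo_support a c.
Proof.
have [w wW] := Wstar_nonempty a.
by apply: le_trans (spo_support_ge c wW); apply: zstar_le; exact: wW.1.
Qed.

(* The support function of [Wstar S a] is the directional derivative of the
   support function of [S] at [a]; this gives the measurability in [a]. *)
Lemma spo_support_cvg a c :
  n.+1%:R * (z a - z (a - n.+1%:R^-1 *: c)) @[n --> \oo] --> spo_support a c.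
Proof.
set s := spo_support a c.
(* Any [w] optimal for [a] is feasible for the perturbed cost, so every difference quotient is at
   least [dot c w]. *)
have lb n : s <= n.+1%:R * (z a - z (a - n.+1%:R^-1 *: c)).
  apply: spo_support_le => w wW.
  have /= := zstar_le (a - n.+1%:R^-1 *: c) wW.1.
  rewrite dotBl dotZl -(zstar_Wstar wW) -/z => h.
  by rewrite -ler_pdivrMl// lerBrDr addrC -lerBrDr.
apply/cvgrPdist_le => e e0.
have [M M0 dotM] := dot_bounded.
(* Compactness gives the margin [h]: points of [S] with [dot c w >= s + e] form a compact set [B],
   and the minimum of [dot a] on [B] exceeds [z a], since equality would put the point in
   [Wstar S a], where [dot c] is at most [s]. *)
have [h [h0 hS]] : exists h : R, 0 < h /\
    forall w, S w -> dot a w < z a + h -> dot c w <= s + e.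
  pose B := S `&` [set w | s + e <= dot c w].
  have Bc : compact B.
    apply: compact_closedI => //.
    apply: (@closed_comp _ _ (dot c) [set x | s + e <= x]).
      by move=> w _; exact: continuous_dotr.
    exact: closed_ge.
  have [B0|] := pselect (B !=set0); last first.
    move=> nB; exists 1; split=> // w Sw _; rewrite leNgt; apply/negP => lt.
    by apply: nB; exists w; split=> //; exact: ltW.
  have [w wB wm] := compact_EVT_min B0 Bc
    (continuous_subspaceT (@continuous_dotr _ _ a)).
  have [Sw sw] := set_mem wB.
  exists (dot a w - z a); split.
    rewrite subr_gt0 lt_neqAle zstar_le// andbT; apply/eqP => zaw.
    have := spo_support_ge c (Wstar_zstar Sw zaw); rewrite -/s => ws.
    by move: sw; rewrite /= => sw; lra.
  move=> v Sv; rewrite addrC subrK => va; rewrite leNgt; apply/negP => lt.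
  have /wm : v \in B by apply: mem_set; split=> //=; exact: ltW.
  by rewrite leNgt va.
near=> n.
rewrite ler0_norm ?subr_le0// opprB lerBlDl.
(* The quotient is at most [dot c w] for this perturbed minimizer, because [z a <= dot a w]. By the
   Lipschitz bound, [dot a w] exceeds [z a] by at most [2 * (M * |c|) / n.+1], eventually less than
   [h]. *)
have [w wW] := Wstar_nonempty (a - n.+1%:R^-1 *: c).
rewrite (zstar_Wstar wW) dotBl dotZl.
have [Sw _] := wW.
apply: (@le_trans _ _ (dot c w)).
  rewrite -ler_pdivlMl//; have := zstar_le a Sw; rewrite -/z.
  by move: (_^-1 * _) => t; lra.
apply: hS => //.
have zz : z (a - n.+1%:R^-1 *: c) - z a <= M * `|n.+1%:R^-1 *: c|.
  apply: le_trans (ler_norm _) (le_trans (zstar_lipschitz dotM _ _) _).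
  by rewrite addrAC subrr sub0r normrN.
move: zz; rewrite (zstar_Wstar wW) dotBl dotZl normrZ gtr0_norm// => zz.
have cw := le_trans (ler_norm _) (dotM c w Sw).
have cw' : n.+1%:R^-1 * dot c w <= n.+1%:R^-1 * (M * `|c|) by rewrite ler_wpM2l.
have : 2 * (M * `|c|) / n.+1%:R < h.
  have nh : 2 * (M * `|c|) / h < n.+1%:R.
    apply: (@lt_trans _ _ n%:R); last by rewrite ltr_nat.
    by near: n; exact: nbhs_infty_gtr.
  by move: nh; rewrite !ltr_pdivrMr// (mulrC h).
move: zz cw'; set q := n.+1%:R^-1; rewrite (mulrCA M q).
lra.
Unshelve. all: by end_near. Qed.

(** A minorant, continuous in [c], of the defect [z c - z (c - 2 *: u) - 2 * dot u (wstar c)], which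
    may itself jump with the oracle. The term in [|c - u|] pays for replacing [dot u (wstar c)] by
    [z c]. *)
Definition spo_plus_gap M (u c : 'rV[R]_d) :=
  Num.max 0 (- z c - z (c - 2 *: u) - 2 * (M * `|c - u|)).

Lemma spo_plus_gap_ge0 M u c : 0 <= spo_plus_gap M u c.
Proof. by rewrite le_max lexx. Qed.

(** The defect is nonnegative because [wstar c] is feasible for the cost [c - 2 *: u]. The other
    bound writes [u] as [c - (c - u)] and uses [z c = dot c (wstar c)]. *)
Lemma spo_plus_gap_le M wstar u c : (forall u w, S w -> `|dot u w| <= M * `|u|) ->
  optimization_oracle S wstar ->
  2 * dot u (wstar c) <= z c - z (c - 2 *: u) - spo_plus_gap M u c.
Proof.
move=> dotM oracle; rewrite lerBrDr -lerBrDl ge_max.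
have zc := zstar_Wstar (oracle c); have [Sw _] := oracle c.
have := zstar_le (c - 2 *: u) Sw; rewrite dotBl dotZl -/z -zc => h1.
apply/andP; split; first by lra.
have := le_trans (ler_norm _) (dotM (- (c - u)) _ Sw).
rewrite normrN dotNl dotBl -zc => h2.
by lra.
Qed.

Lemma spo_plus_gap_continuous M u : continuous (spo_plus_gap M u).
Proof.
have shift (a : 'rV[R]_d) : continuous (fun c => c - a).
  by move=> c; apply: (@cvgB _ _ _ (nbhs c)); [exact: cvg_id|exact: cvg_cst].
move=> c; rewrite /spo_plus_gap.
apply: (@continuous_max R _ (cst 0 : _ -> R^o)
  (fun c => - z c - z (c - 2 *: u) - 2 * (M * `|c - u|) : R^o)).
  exact: cst_continuous.
apply: (@cvgB _ _ _ (nbhs c)); first apply: (@cvgB _ _ _ (nbhs c)).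
- by apply: (@cvgN _ _ _ (nbhs c)); exact: zstar_continuous.
- by apply: (continuous_comp (shift _ c)); exact: zstar_continuous.
- apply: (@cvgMr _ _ (nbhs c)); apply: (@cvgMr _ _ (nbhs c)).
  by apply: (continuous_comp (shift u c)); exact: norm_continuous.
Qed.

(** Minus the left-hand side is the width of [S] in direction [u]; a ball inside [S] contains
    [v - t *: u] and [v + t *: u], which [dot u] separates. *)
Lemma zstar_width_gt0 u : interior S !=set0 -> u != 0 -> z u + z (- u) < 0.
Proof.
move=> [v Sv] u0; have /nbhs_ballP[e /= e0 eS] := Sv.
have n0 : 0 < `|u| by rewrite normr_gt0.
pose t := e / 2 / `|u|.
have t0 : 0 < t by rewrite !divr_gt0.
have tu : `|t *: u| < e.
  rewrite normrZ gtr0_norm// /t divfK ?gt_eqF//; lra.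
have S1 : S (v - t *: u).
  by apply: eS; rewrite -ball_normE /= opprB addrCA subrr addr0.
have S2 : S (v + t *: u).
  by apply: eS; rewrite -ball_normE /= opprD addrA subrr add0r normrN.
have := zstar_le u S1; have := zstar_le (- u) S2.
rewrite dotNl dotDr dotDr -scaleNr !dotZr -/z.
have := mulr_gt0 t0 (dot_gt0 u0).
by rewrite mulNr; lra.
Qed.

Lemma spo_plus_gap_gt0 M u : interior S !=set0 -> u != 0 ->
  0 < spo_plus_gap M u u.
Proof.
move=> Si u0; have := zstar_width_gt0 Si u0.
rewrite lt_max ltxx /= subrr normr0 !mulr0 subr0 scaler_nat mulr2n opprD addrA.
by rewrite subrr sub0r; lra.
Qed.

(** Both values of [z] are at most [M * (|c - u| + |u|)] in absolute value, and the penalty cancels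
    the part growing with [c]. *)
Lemma spo_plus_gap_bound M u c : 0 <= M ->
  (forall u w, S w -> `|dot u w| <= M * `|u|) ->
  spo_plus_gap M u c <= 2 * (M * `|u|).
Proof.
move=> M0 dotM; rewrite ge_max !mulr_ge0//=.
have := zstar_norm_le dotM c; have := zstar_norm_le dotM (c - 2 *: u).
rewrite !ler_norml => /andP[+ _] /andP[+ _].
have : M * `|c| <= M * (`|c - u| + `|u|).
  by rewrite ler_wpM2l// -[X in `|X| <= _](subrK u) ler_normD.
have : M * `|c - 2 *: u| <= M * (`|c - u| + `|u|).
  rewrite ler_wpM2l// scaler_nat mulr2n opprD addrA.
  by rewrite (le_trans (ler_normD _ _))// normrN.
rewrite -/z !mulrDr; lra.
Qed.

Lemma spo_plus_loss_ge0 wstar a c : optimization_oracle S wstar ->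
  0 <= spo_plus_loss S wstar a c.
Proof.
move=> oracle; rewrite spo_plus_lossE.
have zc := zstar_Wstar (oracle c); have [Sw _] := oracle c.
have := zstar_le (2 *: a - c) Sw; rewrite dotBl dotZl -/z -zc.
lra.
Qed.

Definition spo_plus_shift (a b c : 'rV[R]_d) := z (2 *: a - c) - z (2 *: b - c).

(* [2 *: a - c] is the reflection of [c] through [a]: when it is distributed as
   [c], the two shifts integrate to the same value. *)
Lemma spo_plus_loss_reflection M wstar a b c :
  (forall u w, S w -> `|dot u w| <= M * `|u|) -> optimization_oracle S wstar ->
  spo_plus_loss S wstar a c + (spo_plus_shift a b c + spo_plus_gap M (a - b) c)
  <= spo_plus_loss S wstar b c + spo_plus_shift a b (2 *: a - c).
Proof.
move=> dotM oracle; rewrite !spo_plus_lossE /spo_plus_shift.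
have := spo_plus_gap_le (a - b) c dotM oracle.
rewrite subKr dotBl.
have -> : 2 *: b - (2 *: a - c) = c - 2 *: (a - b).
  by rewrite scalerBr opprB opprB addrCA addrC -addrA (addrC _ c) addrA addrAC.
lra.
Qed.

(** The Lipschitz property makes the bound uniform in [c], although [z] alone grows linearly;
    boundedness later allows the integrals to be cancelled. *)
Lemma spo_plus_shift_bound M a b c :
  (forall u w, S w -> `|dot u w| <= M * `|u|) ->
  `|spo_plus_shift a b c| <= M * (2 * `|a - b|).
Proof.
move=> dotM; apply: le_trans (zstar_lipschitz dotM _ _) _.
by rewrite opprB addrA subrK -scalerBr normrZ ger0_norm.
Qed.

Lemma spo_loss_ge0 a c : 0 <= spo_loss S a c.
Proof. by rewrite /spo_loss subr_ge0; exact: zstar_le_spo_support. Qed.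

(** The two costs sum to [2 *: a]. With a single optimal [w] at [a], both suprema on the left are
    taken at the same [w] and add up to [2 * dot a w], which no decision of [S] improves. *)
Lemma spo_loss_reflection a b c : (exists w, Wstar S a = [set w]) ->
  spo_loss S a c + spo_loss S a (2 *: a - c)
  <= spo_loss S b c + spo_loss S b (2 *: a - c).
Proof.
move=> [w aw].
have wW : Wstar S a w by rewrite aw.
have le c' : spo_support a c' <= dot c' w.
  by apply: spo_support_le => w'; rewrite aw => ->.
have [v vW] := Wstar_nonempty b.
have := spo_support_ge c vW; have := spo_support_ge (2 *: a - c) vW.
have := le c; have := le (2 *: a - c); have := wW.2 v vW.1.
by rewrite !dotBl !dotZl /spo_loss -!/(spo_support _ _); lra.
Qed.

End support_function.

(** * Borel measurability of vector-valued maps *)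

Section measurable_row_vectors.
Context (R : realType) (d : nat).

Lemma open_measurable_rV (U : set 'rV[R]_d) : open U -> measurable U.
Proof. by move=> oU; exact: sub_sigma_algebra. Qed.

Lemma continuous_measurable_rV (g : 'rV[R]_d -> R) :
  continuous g -> measurable_fun setT g.
Proof.
move=> cg; apply: (measurability _ (RGenOpens.measurableE R)).
move=> _ [_ [a [b ->]] <-]; rewrite setTI; apply: open_measurable_rV.
by apply: open_comp => //; exact: interval_open.
Qed.

Context {dT : measure_display} {T : measurableType dT}.

Lemma measurable_fun_coord (f : T -> 'rV[R]_d) i :
  measurable_fun setT f -> measurable_fun setT (fun x => f x 0 i).
Proof.
move=> mf; apply: (@measurableT_comp _ _ _ _ _ _ (fun v : 'rV[R]_d => v 0 i)) => //.
exact: continuous_measurable_rV (@coord_continuous _ _ _ _ _).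
Qed.

Lemma measurable_fun_rV (f : T -> 'rV[R]_d) :
  (forall i, measurable_fun setT (fun x => f x 0 i)) -> measurable_fun setT f.
Proof.
move=> mf; apply: (measurability (@open 'rV[R]_d)) => //.
move=> _ [U oU <-]; rewrite setTI.
(* Boxes with rational centre and radius [1 / (n + 1)] form a countable base. A box not inside [U]
   contributes the empty set, so the union runs over a countable type. *)
pose box (q : 'rV[rat]_d * nat) : set 'rV[R]_d :=
  [set v | forall i, `|v 0 i - ratr (q.1 0 i)| < q.2.+1%:R^-1].
pose F q := if `[< box q `<=` U >] then f @^-1` box q else set0.
suff -> : f @^-1` U = \bigcup_q F q.
  apply: countable_bigcupT_measurable => [|q]; first exact: countableP.
  rewrite /F; case: ifP => // _.
  rewrite (_ : f @^-1` _ = \bigcap_i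
      (fun x => `|f x 0 i - ratr (q.1 0 i)|) @^-1` [set r | r < q.2.+1%:R^-1]).
    apply: fin_bigcap_measurable => [|i _]; first exact: finite_finset.
    rewrite -[X in measurable X]setTI.
    apply: (_ : measurable_fun setT (fun x => `|f x 0 i - ratr (q.1 0 i)|)) => //.
      by apply: measurableT_comp => //; apply: measurable_funB => //; exact: mf.
    by rewrite -set_itvNyo; exact: measurable_itv.
  by apply/seteqP; split=> [x h i _|x h i]; exact: h.
apply/seteqP; split=> [x /= Ux|x [q _]]; last first.
  by rewrite /F; case: ifP => // /asboolP + /=; exact.
have /nbhs_ballP[e /= e0 eU] : nbhs (f x) U by exact: open_nbhs_nbhs.
(* Two points of a box differ by less than twice its radius in each coordinate, so such a box around
   [f x] stays in the ball of radius [e]. *)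
have [n ne] : exists n, n.+1%:R^-1 + n.+1%:R^-1 < e.
  have [n _ /(_ n (leqnn n))/= ne] :=
    near_infty_natSinv_lt (PosNum (divr_gt0 e0 (ltr0n R 2))).
  by exists n; rewrite [e]splitr ltrD.
have rq i : exists q : rat, `|f x 0 i - ratr q| < n.+1%:R^-1 :> R.
  have [|q] := @rat_in_itvoo R (f x 0 i) (f x 0 i + n.+1%:R^-1).
    by rewrite ltrDl.
  rewrite in_itv/= => /andP[q1 q2]; exists q.
  by rewrite distrC ger0_norm ?subr_ge0 1?ltW// ltrBlDl.
pose q : 'rV[rat]_d := \row_i projT1 (cid (rq i)).
have fq i : `|f x 0 i - ratr (q 0 i)| < n.+1%:R^-1.
  by rewrite mxE; exact: projT2 (cid (rq i)).
exists (q, n) => //; rewrite /F; case: asboolP => //= nU.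
exfalso; apply: nU => v vq; apply: eU; split=> // i j; rewrite (ord1 i).
rewrite -ball_normE /=; apply: lt_trans ne.
rewrite -(subrKA (ratr (q 0 j))) (le_lt_trans (ler_normD _ _))// ltrD// distrC.
exact: vq.
Qed.

Lemma measurable_lincomb_rV (a b : R) (f g : T -> 'rV[R]_d) :
  measurable_fun setT f -> measurable_fun setT g ->
  measurable_fun setT (fun x => a *: f x + b *: g x).
Proof.
move=> mf mg; apply: measurable_fun_rV => i.
under eq_fun do rewrite !mxE.
by apply: measurable_funD; apply: measurable_funM => //; exact: measurable_fun_coord.
Qed.

Lemma measurable_norm_rV (f : T -> 'rV[R]_d) :
  measurable_fun setT f -> measurable_fun setT (fun x => `|f x|).
Proof.
move=> mf; have mn : measurable_fun setT (fun v : 'rV[R]_d => `|v|).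
  by apply: continuous_measurable_rV; exact: norm_continuous.
exact: measurableT_comp mn mf.
Qed.

End measurable_row_vectors.

(** * Integrals of nonnegative, possibly nonmeasurable functions *)

Section lower_integral.
Context {dT : measure_display} {T : measurableType dT} {R : realType}.
Variable mu : {measure set T -> \bar R}.
Local Open Scope ereal_scope.
Implicit Types f g : T -> \bar R.

Import HBNNSimple.

Lemma ge0_integralT_le_sup f l : (forall x, 0 <= f x) ->
  (forall h : {nnsfun T >-> R}, (forall x, (h x)%:E <= f x) ->
    \int[mu]_x (h x)%:E <= l) -> \int[mu]_x f x <= l.
Proof.
move=> f0 hl; rewrite ge0_integralTE//; apply: ge_ereal_sup => _ [h hf <-].
by rewrite -integralT_nnsfun; exact: hl.
Qed.

Lemma nnsfun_le_integralT f (h : {nnsfun T >-> R}) : (forall x, 0 <= f x) ->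
  (forall x, (h x)%:E <= f x) -> \int[mu]_x (h x)%:E <= \int[mu]_x f x.
Proof.
move=> f0 hf; rewrite (ge0_integralTE _ f0) integralT_nnsfun.
by apply: ereal_sup_ubound; exists h.
Qed.

Lemma ge0_le_integralT f g : (forall x, 0 <= f x) -> (forall x, f x <= g x) ->
  \int[mu]_x f x <= \int[mu]_x g x.
Proof.
move=> f0 fg; apply: ge0_integralT_le_sup => // h hf.
apply: nnsfun_le_integralT => x; first exact: le_trans (fg x).
exact: le_trans (fg x).
Qed.

(** Superadditivity adds [g] to a simple function below [f]; the finite integral of [g] can then be
    moved across the inequality. *)
Lemma ge0_integralTD_measurabler f (g : T -> R) : (forall x, 0 <= f x) ->
  (forall x, 0 <= g x)%R -> measurable_fun setT g -> \int[mu]_x (g x)%:E < +oo ->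
  \int[mu]_x (f x + (g x)%:E) = \int[mu]_x f x + \int[mu]_x (g x)%:E.
Proof.
move=> f0 g0 mg goo.
have mg' : measurable_fun setT (EFin \o g) by exact/measurable_EFinP.
have gfin : \int[mu]_x (g x)%:E \is a fin_num.
  by rewrite ge0_fin_numE// integral_ge0// => x _; rewrite lee_fin.
apply/eqP; rewrite eq_le; apply/andP; split.
  apply: ge0_integralT_le_sup => [x|h hfg].
    by rewrite adde_ge0// lee_fin.
  (* For the upper bound, [h] is below [p + g], where [p] is measurable and still below [f], so
     ordinary additivity applies to [p + g]. *)
  pose p x := Num.max 0%R (h x - g x)%R.
  have mp : measurable_fun setT (EFin \o p).
    by apply/measurable_EFinP; apply: measurable_maxr => //; exact: measurable_funB.
  apply: (@le_trans _ _ (\int[mu]_x ((p x)%:E + (g x)%:E))).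
    apply: ge0_le_integralT => x; rewrite ?lee_fin//.
    by rewrite -lerBlDr /p le_max lexx orbT.
  rewrite ge0_integralD//; last 2 first.
  - by move=> x _; rewrite lee_fin /p le_max lexx.
  - by move=> x _; rewrite lee_fin.
  rewrite leeD2r//; apply: ge0_le_integralT => x.
    by rewrite lee_fin /p le_max lexx.
  have := hfg x; case: (f x) (f0 x) => [r|_ _|//]; last by rewrite leey.
  by rewrite !lee_fin ge_max => -> /=; rewrite lerBlDr.
rewrite -leeBrDr//; apply: ge0_integralT_le_sup => // h hf.
rewrite leeBrDr// -ge0_integralD//.
- by apply: ge0_le_integralT => x; rewrite ?adde_ge0 ?lee_fin// leeD2r.
- by move=> x _; rewrite lee_fin.
- exact/measurable_EFinP.
- by move=> x _; rewrite lee_fin.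
Qed.

Lemma ge0_integral_eq0_negligible f :
  (forall x, 0 <= f x) -> measurable_fun setT f -> \int[mu]_x f x <= 0 ->
  mu.-negligible [set x | 0 < f x].
Proof.
move=> f0 mf fle.
have /(ae_eq_integral_abs mu measurableT mf) : \int[mu]_x `|f x| = 0.
  apply/eqP; rewrite eq_le integral_ge0// andbT; apply: le_trans fle.
  rewrite le_eqVlt; apply/orP; left; apply/eqP; apply: eq_integral => x _.
  by rewrite gee0_abs.
apply: negligibleS => x /= fx /(_ I) fx0.
by move: fx; rewrite fx0 ltxx.
Qed.

Lemma bounded_integral_lty (f : T -> R) B : mu setT < +oo ->
  (forall x, 0 <= f x)%R -> (forall x, f x <= B)%R ->
  \int[mu]_x (f x)%:E < +oo.
Proof.
move=> muoo f0 fB; apply: (@le_lt_trans _ _ (\int[mu]_x B%:E)).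
  by apply: ge0_le_integralT => x; rewrite lee_fin.
rewrite integral_cst// lte_mul_pinfty// lee_fin.
exact: le_trans (f0 point) (fB point).
Qed.

(** Integrating the pointwise inequality and cancelling the finite integrals of [l] and [g] leaves a
    nonpositive integral of [h]. Here [l] and [l'] stand for losses depending on the oracle, so only
    [g], [g'] and [h] are measurable. *)
Lemma excess_negligible (l l' g g' h : T -> R) B B' : mu setT < +oo ->
  (forall x, 0 <= l x)%R -> (forall x, 0 <= l' x)%R ->
  (forall x, 0 <= g x)%R -> (forall x, g x <= B)%R -> measurable_fun setT g ->
  (forall x, 0 <= g' x)%R -> (forall x, g' x <= B)%R -> measurable_fun setT g' ->
  (forall x, 0 <= h x)%R -> (forall x, h x <= B')%R -> measurable_fun setT h ->
  \int[mu]_x (g' x)%:E = \int[mu]_x (g x)%:E ->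
  (forall x, l' x + (g x + h x) <= l x + g' x)%R ->
  \int[mu]_x (l x)%:E < +oo -> \int[mu]_x (l x)%:E <= \int[mu]_x (l' x)%:E ->
  mu.-negligible [set x | (0 < h x)%R].
Proof.
move=> muoo l0 l'0 g0 gB mg g'0 g'B mg' h0 hB mh gg' lgh loo ll'.
have gh0 x : (0 <= g x + h x)%R by rewrite addr_ge0.
have mgh : measurable_fun setT (g \+ h)%R by exact: measurable_funD.
have ghoo : \int[mu]_x (g x + h x)%:E < +oo.
  apply: (@bounded_integral_lty (g \+ h)%R (B + B')%R muoo gh0) => x.
  exact: lerD.
have goo := bounded_integral_lty muoo g0 gB.
have g'oo := bounded_integral_lty muoo g'0 g'B.
have lfin : \int[mu]_x (l x)%:E \is a fin_num.
  by rewrite ge0_fin_numE// integral_ge0// => x _; rewrite lee_fin.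
have gfin : \int[mu]_x (g x)%:E \is a fin_num.
  by rewrite ge0_fin_numE// integral_ge0// => x _; rewrite lee_fin.
have key : \int[mu]_x (l' x)%:E + \int[mu]_x (g x + h x)%:E <=
           \int[mu]_x (l x)%:E + \int[mu]_x (g' x)%:E.
  have El0 (u : T -> R) (u0 : forall x, (0 <= u x)%R) x : 0 <= (u x)%:E.
    by rewrite lee_fin.
  rewrite -(ge0_integralTD_measurabler (El0 _ l'0) gh0 mgh ghoo).
  rewrite -(ge0_integralTD_measurabler (El0 _ l0) g'0 mg' g'oo).
  by apply: ge0_le_integralT => x; rewrite -?EFinD lee_fin// addr_ge0.
have hneg : mu.-negligible [set x | 0 < (h x)%:E].
  apply: ge0_integral_eq0_negligible; first by move=> x; rewrite lee_fin.
    exact/measurable_EFinP.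
  rewrite -(leeD2lE _ _ gfin) adde0 -(leeD2lE _ _ lfin).
  have -> : \int[mu]_x (g x)%:E + \int[mu]_x (h x)%:E = \int[mu]_x (g x + h x)%:E.
    rewrite -ge0_integralD//.
    - by move=> x _; rewrite lee_fin.
    - exact/measurable_EFinP.
    - by move=> x _; rewrite lee_fin.
    - exact/measurable_EFinP.
  by rewrite -[X in _ <= _ + X]gg'; apply: le_trans key; rewrite leeD2r.
by apply: negligibleS hneg => x /=; rewrite lte_fin.
Qed.

End lower_integral.

(** * Disintegration of the joint law *)

Section conditional_law.
Context {dT : measure_display} {T : measurableType dT} {R : realType} {d : nat}.
Variables (D : probability (T * 'rV[R]_d)%type R) (k : R.-pker T ~> 'rV[R]_d).
Hypothesis kD : regular_conditional_law D k.

(** The set function [feature_law D] equipped with its measure structure. *)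
Definition feature_measure : {measure set T -> \bar R} :=
  measure_function_pushforward__canonical__measure_function_Measure D
    (@measurable_fst _ _ T 'rV[R]_d).

Lemma measurable_kernel_xsection E : measurable E ->
  measurable_fun setT (fun x => k x (xsection E x)).
Proof.
by move=> mE; apply: measurable_fun_xsection_finite_kernel; exact: mem_set.
Qed.

(** Each coordinate is [fine] of a difference of two kernel integrals, those of the positive and
    negative parts. *)
Lemma measurable_mean_of : measurable_fun setT (fun x => mean_of (k x)).
Proof.
apply: measurable_fun_rV => i; rewrite /mean_of.
under eq_fun do rewrite mxE.
apply: (@measurableT_comp _ _ _ _ _ _ fine) => //.
have mc : measurable_fun setT (fun v : 'rV[R]_d => (v 0 i)%:E).
  apply/measurable_EFinP; apply: continuous_measurable_rV.
  exact: coord_continuous.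
under eq_fun do rewrite integralE.
apply: emeasurable_funB; apply: measurable_fun_integral_kernel => //.
- by move=> U mU; exact: measurable_kernel.
- exact: measurable_funepos.
- by move=> U mU; exact: measurable_kernel.
- exact: measurable_funeneg.
Qed.

Local Open Scope ereal_scope.

Let joint (E : set (T * 'rV[R]_d)) := \int[feature_measure]_x k x (xsection E x).

Let joint0 : joint set0 = 0.
Proof. by rewrite /joint integral0_eq// => x _; rewrite xsection0 measure0. Qed.

Let joint_ge0 E : 0 <= joint E.
Proof. by apply: integral_ge0. Qed.

Let joint_sigma_additive : semi_sigma_additive joint.
Proof.
move=> F mF tF mUF.
rewrite [X in _ --> X](_ : _ = \sum_(n <oo) joint (F n)).
  apply/cvg_closeP; split; last by rewrite closeE.
  by apply: is_cvg_nneseries => *; exact: integral_ge0.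
rewrite -integral_nneseries//; last by move=> n; exact: measurable_kernel_xsection.
apply: eq_integral => x _; rewrite xsection_bigcup; apply/esym/cvg_lim => //=.
apply: measure_sigma_additive; last exact: trivIset_xsection.
by move=> ?; exact: measurable_xsection.
Qed.

Let joint_measure : {measure set (T * 'rV[R]_d) -> \bar R} :=
  HB.pack joint (isMeasure.Build _ _ _ joint joint0 joint_ge0 joint_sigma_additive).

(** Both sides are measures in [E] that agree on rectangles, an intersection-stable generator of the
    product sigma-algebra. *)
Lemma conditional_lawE E : measurable E ->
  D E = \int[feature_measure]_x k x (xsection E x).
Proof.
move=> mE.
pose C : set (set (T * 'rV[R]_d)) :=
  [set C | exists A, measurable A /\ exists B, measurable B /\ C = A `*` B].
have CI : setI_closed C.
  move=> /= _ _ [X1 [mX1 [X2 [mX2 ->]]]] [Y1 [mY1 [Y2 [mY2 ->]]]].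
  rewrite -setXI; exists (X1 `&` Y1); split; first exact: measurableI.
  by exists (X2 `&` Y2); split => //; exact: measurableI.
apply: (@measure_unique _ _ _ C (fun=> setT) _ CI _ _ D joint_measure) => //.
- rewrite measurable_prod_measurableType //; congr (<<s _ >>).
  rewrite predeqE; split => [[A mA [B mB <-]]|[A [mA [B [mB ->]]]]].
    by exists A; split => //; exists B.
  by exists A => //; exists B.
- by move=> n; exists setT; split => //; exists setT; split => //; rewrite setXTT.
- by rewrite bigcup_const.
- move=> A [A1 [mA1 [A2 [mA2 ->]]]]; apply: (eq_trans (kD mA1 mA2)).
  rewrite /joint_measure /= /joint.
  rewrite [LHS]integral_mkcond; apply: eq_integral => x _ /=.
  rewrite patchE; case: ifPn => xA; last by rewrite notin_xsectionX// measure0.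
  by rewrite in_xsectionX.
- by move=> _; apply: (le_lt_trans (probability_le1 D measurableT)); exact: ltry.
Qed.

End conditional_law.

(** * Invariance of the joint law under reflection in the conditional mean *)

Section reflection.
Context {dT : measure_display} {T : measurableType dT} {R : realType} {d : nat}.
Variables (D : probability (T * 'rV[R]_d)%type R) (k : R.-pker T ~> 'rV[R]_d).
Hypothesis kD : regular_conditional_law D k.
Hypothesis k_symmetric : forall x, centrally_symmetric (k x).

Let m x := mean_of (k x).

Definition mean_reflection (q : T * 'rV[R]_d) : T * 'rV[R]_d :=
  (q.1, 2 *: mean_of (k q.1) - q.2).

Lemma measurable_mean_reflection : measurable_fun setT mean_reflection.
Proof.
apply/measurable_fun_pairP; split; first exact: measurable_fst.
apply: measurable_fun_rV => i.
rewrite [X in measurable_fun _ X](_ : _ =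
  (fun q : T * 'rV[R]_d => 2 * m q.1 0 i - q.2 0 i)); last first.
  by apply/funext => q /=; rewrite !mxE.
apply: measurable_funB; last first.
  by apply: measurable_fun_coord; exact: measurable_snd.
apply: measurable_funM => //; apply: measurable_fun_coord.
exact: measurableT_comp (measurable_mean_of k) measurable_fst.
Qed.

(** The reflection fixes the feature, so disintegration reduces the claim to central symmetry of
    each [k x]. *)
Lemma mean_reflection_preserving E : measurable E ->
  D (mean_reflection @^-1` E) = D E.
Proof.
move=> mE; have mE' : measurable (mean_reflection @^-1` E).
  by rewrite -[X in measurable X]setTI; exact: measurable_mean_reflection.
rewrite !(conditional_lawE kD)//; apply: eq_integral => x _.
rewrite -[RHS](k_symmetric x); last exact: measurable_xsection.
by rewrite /pushforward !xsectionE.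
Qed.

Lemma integral_mean_reflection (f : T * 'rV[R]_d -> \bar R) :
  (forall q, 0 <= f q)%E -> measurable_fun setT f ->
  (\int[D]_q f (mean_reflection q) = \int[D]_q f q)%E.
Proof.
move=> f0 mf.
rewrite -[LHS](ge0_integral_pushforward measurable_mean_reflection D measurableT)//.
apply: (@eq_measure_integral _ _ _ _ D
  (measure_function_pushforward__canonical__measure_function_Measure D
    measurable_mean_reflection)) => E mE _.
exact: mean_reflection_preserving.
Qed.

End reflection.

(** * Risk comparison and identification of SPO+ minimizers *)

Section spo_plus_minimizers.
Context {dT : measure_display} {T : measurableType dT} {R : realType} {d : nat}.
Variables (S : set 'rV[R]_d) (wstar : 'rV[R]_d -> 'rV[R]_d).
Hypotheses (S0 : S !=set0) (Sc : compact S) (Si : interior S !=set0).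
Hypothesis oracle : optimization_oracle S wstar.
Variables (D : probability (T * 'rV[R]_d)%type R) (k : R.-pker T ~> 'rV[R]_d).
Hypothesis c_integrable : (\int[D]_q `|q.2|%:E < +oo)%E.
Hypothesis kD : regular_conditional_law D k.
Hypothesis k_symmetric : forall x, centrally_symmetric (k x).

Let m x := mean_of (k x).
Let mm : measurable_fun setT m. Proof. exact: measurable_mean_of. Qed.

Lemma measurable_zstar {dU : measure_display} {U : measurableType dU}
    (f : U -> 'rV[R]_d) :
  measurable_fun setT f -> measurable_fun setT (fun x => zstar S (f x)).
Proof.
move=> mf; have mz : measurable_fun setT (zstar S).
  by apply: continuous_measurable_rV; exact: zstar_continuous.
exact: measurableT_comp mz mf.
Qed.

(** The supremum over [Wstar] is a pointwise limit of difference quotients of the continuous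
    [zstar S]. *)
Lemma measurable_spo_loss (f : T -> 'rV[R]_d) : measurable_fun setT f ->
  measurable_fun setT (fun q : T * 'rV[R]_d => spo_loss S (f q.1) q.2).
Proof.
move=> mf; have mf1 : measurable_fun setT (fun q : T * 'rV[R]_d => f q.1).
  exact: measurableT_comp mf measurable_fst.
apply: measurable_funB; last by apply: measurable_zstar; exact: measurable_snd.
apply: (@measurable_fun_cvg _ _ _ _ (fun n (q : T * 'rV[R]_d) =>
  n.+1%:R * (zstar S (f q.1) - zstar S (f q.1 - n.+1%:R^-1 *: q.2)))).
  move=> n; apply: measurable_funM => //; apply: measurable_funB.
    exact: measurable_zstar.
  apply: measurable_zstar; under eq_fun do rewrite -[f _]scale1r -scaleNr.
  by apply: measurable_lincomb_rV => //; exact: measurable_snd.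
by move=> q _; exact: spo_support_cvg.
Qed.

Lemma spo_risk_le (f g : T -> 'rV[R]_d) :
  {ae feature_measure D, forall x, exists w, Wstar S (m x) = [set w]} ->
  {ae feature_measure D, forall x, f x = m x} ->
  measurable_fun setT f -> measurable_fun setT g ->
  (risk D (spo_loss S) f <= risk D (spo_loss S) g)%E.
Proof.
move=> uniq fm mf mg.
have mQ h : measurable_fun setT h -> measurable_fun setT
    (fun q : T * 'rV[R]_d => (spo_loss S (h q.1) q.2)%:E).
  by move=> mh; apply/measurable_EFinP; exact: measurable_spo_loss.
have Q0 h (q : T * 'rV[R]_d) : (0 <= (spo_loss S (h q.1) q.2)%:E)%E.
  by rewrite lee_fin spo_loss_ge0.
have mQr h : measurable_fun setT h -> measurable_fun setT
    (fun q => (spo_loss S (h q.1) (mean_reflection k q).2)%:E).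
  move=> mh; exact: measurableT_comp (mQ h mh) (measurable_mean_reflection k).
(* Adding the reflected loss doubles the risk, so the two risks can be compared through the
   pointwise reflection inequality. *)
have twice h : measurable_fun setT h ->
    (\int[D]_q ((spo_loss S (h q.1) q.2)%:E +
      (spo_loss S (h q.1) (mean_reflection k q).2)%:E) =
     2%:E * risk D (spo_loss S) h)%E.
  move=> mh; rewrite ge0_integralD//; last 3 first.
  - exact: mQ.
  - by move=> q _; rewrite lee_fin spo_loss_ge0.
  - exact: mQr.
  have := integral_mean_reflection kD k_symmetric (Q0 h) (mQ h mh).
  by rewrite /risk /= => ->; rewrite mule_natl mule2n.
rewrite -(@lee_pmul2l _ 2%:E)// -!twice//.
apply: ae_ge0_le_integral => //.
- by move=> q _; rewrite adde_ge0// lee_fin spo_loss_ge0.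
- by apply: emeasurable_funD; [exact: mQ|exact: mQr].
- by move=> q _; rewrite adde_ge0// lee_fin spo_loss_ge0.
- by apply: emeasurable_funD; [exact: mQ|exact: mQr].
have [N [mN N0 hN]] : {ae feature_measure D, forall x,
    f x = m x /\ exists w, Wstar S (m x) = [set w]}.
  by apply: filterS2 fm uniq.
exists (fst @^-1` N); split=> //.
  by rewrite -[X in measurable X]setTI; exact: measurable_fst.
move=> q /= nq; apply: hN => /= -[fq uq]; apply: nq => _.
by rewrite fq -!EFinD lee_fin; exact: spo_loss_reflection.
Qed.

(** At the zero prediction the loss is [- z (- c) - z c], at most [2 * M * |c|]. Comparison with
    this predictor makes the risk of any minimizer finite. *)
Lemma spo_plus_risk0_lty : (risk D (spo_plus_loss S wstar) (fun=> 0%R) < +oo)%E.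
Proof.
have [M M0 dotM] := dot_bounded Sc.
apply: (@le_lt_trans _ _ (\int[D]_q ((2 * M)%:E * `|q.2|%:E))%E).
  apply: ge0_le_integralT => q; first by rewrite lee_fin spo_plus_loss_ge0.
  rewrite -EFinM lee_fin spo_plus_lossE// -mulrA /=.
  have zM c : - (M * `|c|) <= zstar S c.
    by have := zstar_norm_le S0 Sc dotM c; rewrite ler_norml => /andP[].
  have := zM q.2; have := zM (- q.2); rewrite normrN scaler0 sub0r.
  have -> : dot 0 (wstar q.2) = 0 :> R by rewrite -(scale0r 0) dotZl mul0r.
  lra.
rewrite ge0_integralZl//.
- by rewrite lte_mul_pinfty// lee_fin mulr_ge0.
- apply/measurable_EFinP; apply: measurable_norm_rV; exact: measurable_snd.
- by rewrite lee_fin mulr_ge0.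
Qed.

Lemma spo_plus_minimizer_gap M (f : T -> 'rV[R]_d) (n : nat) : 0 <= M ->
  (forall u w, S w -> `|dot u w| <= M * `|u|) ->
  risk_minimizer D (spo_plus_loss S wstar) f ->
  D.-negligible [set q | `|m q.1 - f q.1| <= n%:R /\
                         0 < spo_plus_gap S M (m q.1 - f q.1) q.2].
Proof.
move=> M0 dotM [mf fmin].
pose A (x : T) := `|m x - f x| <= n%:R.
have mu : measurable_fun setT (fun x => m x - f x).
  under eq_fun do rewrite -[m _]scale1r -scaleN1r.
  exact: measurable_lincomb_rV.
have mA : measurable_fun setT A.
  by apply: measurable_fun_ler => //; exact: measurable_norm_rV.
(* The competitor moves to the mean only where the displacement is at most [n], which keeps the
   shift and the gap bounded. *)
pose fn x := if A x then m x else f x.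
have mfn : measurable_fun setT fn by exact: measurable_fun_ifT.
pose C := M * (2 * n%:R).
have Dlty : (D setT < +oo)%E.
  by apply: (le_lt_trans (probability_le1 D measurableT)); exact: ltry.
have C0 : 0 <= C by rewrite !mulr_ge0.
pose v (q : T * 'rV[R]_d) := spo_plus_shift S (m q.1) (f q.1) q.2.
(* Adding [C] makes the shift nonnegative. The reflection fixes [q.1], hence [A], so the constant
   appears equally in [g] and in its reflection [gr]. *)
pose g q := if A q.1 then v q + C else 0.
pose h (q : T * 'rV[R]_d) :=
  if A q.1 then spo_plus_gap S M (m q.1 - f q.1) q.2 else 0.
have m1 (F : T -> 'rV[R]_d) : measurable_fun setT F ->
    measurable_fun setT (fun q : T * 'rV[R]_d => F q.1).
  by move=> mF; exact: measurableT_comp mF measurable_fst.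
have mA1 : measurable_fun setT (fun q : T * 'rV[R]_d => A q.1).
  exact: measurableT_comp mA measurable_fst.
have m2 : measurable_fun setT (fun q : T * 'rV[R]_d => q.2) by exact: measurable_snd.
have mg : measurable_fun setT g.
  apply: measurable_fun_ifT => //; apply: measurable_funD => //.
  apply: measurable_funB; apply: measurable_zstar;
    under eq_fun do rewrite -scaleN1r; apply: measurable_lincomb_rV => //; exact: m1.
have mh : measurable_fun setT h.
  apply: measurable_fun_ifT => //; apply: measurable_maxr => //.
  apply: measurable_funB; first apply: measurable_funB.
  - by apply: measurableT_comp => //; exact: measurable_zstar.
  - apply: measurable_zstar; under eq_fun do rewrite -[_.2]scale1r -scaleNr.
    by apply: measurable_lincomb_rV => //; exact: (m1 _ mu).
  apply: measurable_funM => //; apply: measurable_funM => //.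
  apply: measurable_norm_rV.
  under eq_fun do rewrite -[_.2]scale1r -scaleN1r.
  by apply: measurable_lincomb_rV => //; exact: (m1 _ mu).
have vC q : A q.1 -> `|v q| <= C.
  move=> Aq; apply: le_trans (spo_plus_shift_bound S0 Sc _ _ _ dotM) _ => //.
  by rewrite ler_wpM2l// ler_wpM2l.
have g0 q : 0 <= g q.
  by rewrite /g; case: ifPn => // /vC; rewrite ler_norml => /andP[+ _]; lra.
have gC q : g q <= 2 * C.
  rewrite /g; case: ifPn => [/vC|_]; last by rewrite mulr_ge0.
  by rewrite ler_norml => /andP[_]; lra.
have h0 q : 0 <= h q by rewrite /h; case: ifPn => // _; exact: spo_plus_gap_ge0.
have hC q : h q <= C.
  rewrite /h; case: ifPn => // Aq.
  apply: le_trans (spo_plus_gap_bound S0 Sc _ _ M0 dotM) _ => //.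
  by rewrite mulrCA ler_wpM2l// ler_wpM2l.
pose gr q := g (mean_reflection k q).
have mgr : measurable_fun setT gr.
  exact: measurableT_comp mg (measurable_mean_reflection k).
have intgr : (\int[D]_q (gr q)%:E = \int[D]_q (g q)%:E)%E.
  apply: (integral_mean_reflection kD k_symmetric (f := fun q => (g q)%:E)) => [q|].
    by rewrite lee_fin.
  exact/measurable_EFinP.
have lp0 F (q : T * 'rV[R]_d) : (0 <= (spo_plus_loss S wstar (F q.1) q.2)%:E)%E.
  by rewrite lee_fin spo_plus_loss_ge0.
have key q : spo_plus_loss S wstar (fn q.1) q.2 + (g q + h q) <=
    spo_plus_loss S wstar (f q.1) q.2 + gr q.
  rewrite /fn /gr /g /h /=; case: ifPn => Aq; last by rewrite !addr0.
  have := spo_plus_loss_reflection S0 Sc (m q.1) (f q.1) q.2 dotM oracle.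
  by rewrite /v /= -/(m q.1); lra.
have rlty : (\int[D]_q (spo_plus_loss S wstar (f q.1) q.2)%:E < +oo)%E.
  exact: le_lt_trans (fmin (fun=> 0) (measurable_cst _)) spo_plus_risk0_lty.
have hneg := excess_negligible Dlty
  (fun q => spo_plus_loss_ge0 S0 Sc (f q.1) q.2 oracle)
  (fun q => spo_plus_loss_ge0 S0 Sc (fn q.1) q.2 oracle)
  g0 gC mg (fun q => g0 _) (fun q => gC _) mgr h0 hC mh intgr key rlty (fmin fn mfn).
apply: negligibleS hneg => q /= [Aq qg].
by rewrite /h ifT.
Qed.

Lemma spo_plus_minimizer_mean (f : T -> 'rV[R]_d) :
  (forall x, support_of (k x) = setT) ->
  risk_minimizer D (spo_plus_loss S wstar) f ->
  {ae feature_measure D, forall x, f x = m x}.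
Proof.
move=> ksupp fmin.
have [M M0 dotM] := dot_bounded Sc.
pose E n := [set q : T * 'rV[R]_d | `|m q.1 - f q.1| <= n%:R /\
                         0 < spo_plus_gap S M (m q.1 - f q.1) q.2].
(* Almost every [x] has a [k x]-null section of the null set [N]; full support gives every nonempty
   open set positive mass, so such a section contains none. *)
have Eneg n : (feature_measure D).-negligible
    [set x | exists2 U, open U & U !=set0 /\ forall c, U c -> E n (x, c)].
  have [N [mN N0 EN]] := spo_plus_minimizer_gap n M0 dotM fmin.
  have : (feature_measure D).-negligible [set x | (0 < k x (xsection N x))%E].
    apply: ge0_integral_eq0_negligible => //.
      exact: measurable_kernel_xsection.
    by rewrite -(conditional_lawE kD mN) N0.
  apply: negligibleS => x /= [U oU [[c Uc] UE]].
  have : support_of (k x) c by rewrite ksupp.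
  move=> /(_ U oU Uc) kU; apply: lt_le_trans kU _.
  apply: le_measure; rewrite ?inE.
  - exact: open_measurable_rV.
  - exact: measurable_xsection.
  - by move=> c' Uc'; rewrite xsectionE /=; apply: EN; exact: UE.
apply: negligibleS (negligible_bigcup Eneg) => x /= fx.
have u0 : m x - f x != 0 by rewrite subr_eq0; apply/eqP => e; exact: fx.
(* If [f x] differs from [m x], the gap is positive at [c = m x - f x], hence on an open set by
   continuity; this index bounds the displacement. *)
exists (Num.bound `|m x - f x|) => //=.
exists [set c | 0 < spo_plus_gap S M (m x - f x) c].
  apply: (@open_comp _ _ (spo_plus_gap S M (m x - f x)) [set r | 0 < r]).
    by move=> c _; exact: (@spo_plus_gap_continuous _ _ _ S0 Sc M (m x - f x) c).
  exact: open_gt.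
split; first by exists (m x - f x); exact: spo_plus_gap_gt0.
move=> c /= cg; split => //=.
by apply: ltW; apply: archi_boundP.
Qed.

End spo_plus_minimizers.

Theorem theorem1 (R : realType) (d p : nat)
  (S : set 'rV[R]_d)
  (S_nonempty : S !=set0) (S_compact : compact S) (S_convex : convex_set S)
  (wstar : 'rV[R]_d -> 'rV[R]_d) (wstar_oracle : optimization_oracle S wstar)
  (X : set 'rV[R]_p) (X_nonempty : X !=set0)
  (D : probability (feature_space X_nonempty * 'rV[R]_d)%type R)
  (c_integrable : (\int[D]_q `|q.2|%:E < +oo)%E)
  (k : R.-pker (feature_space X_nonempty) ~> 'rV[R]_d)
  (k_cond : regular_conditional_law D k)
  (W_singleton : {ae feature_law D, forall x,
     exists w, Wstar S (mean_of (k x)) = [set w]})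
  (k_symmetric : forall x, centrally_symmetric (k x))
  (k_continuous : forall x, continuous_on_all_of_Rd (k x))
  (S_interior : interior S !=set0) :
  (forall f : feature_space X_nonempty -> 'rV[R]_d,
     risk_minimizer D (spo_plus_loss S wstar) f ->
     {ae feature_law D, forall x, f x = mean_of (k x)} /\
     risk_minimizer D (spo_loss S) f) /\
  fisher_consistent D (spo_plus_loss S wstar) (spo_loss S).
Proof.
suff main f : risk_minimizer D (spo_plus_loss S wstar) f ->
    {ae feature_law D, forall x, f x = mean_of (k x)} /\
    risk_minimizer D (spo_loss S) f.
  by split=> // f /main[].
move=> fmin.
have fmean := spo_plus_minimizer_mean S_nonempty S_compact S_interior
  wstar_oracle c_integrable k_cond k_symmetric (fun x => (k_continuous x).2) fmin.
split=> //; split=> [|g mg]; first exact: fmin.1.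
exact: (spo_risk_le S_nonempty S_compact k_cond k_symmetric W_singleton fmean
  fmin.1 mg).
Qed.
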